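(* Let $\kappa$ be a positive integer, $\Omega=\{X\in\mathbb{H}^n_+ : \mathrm{tr}(X)=1\}$ and $\mathcal{F}=\{X\in\Omega : \mathrm{rank}(X)\le\kappa\}$. Then for any $X\in\Omega$ with eigenvalue decomposition $X=\sum_{i=1}^n\lambda_i(X)u_iu_i^{\mathbb{T}}$, $$\mathrm{dist}(X,\mathcal{F})\le\sqrt{\|X-\Pi_{\mathcal{R}}(X)\|_F^2+\|X-\Pi_{\mathcal{R}}(X)\|_*^2}\quad\text{with}\quad \Pi_{\mathcal{R}}(X):=\sum_{i=1}^{\kappa}\lambda_i(X)u_iu_i^{\mathbb{T}}.$$ In particular, $\Gamma(t)\subseteq\Gamma(0)+\sqrt{2}\,|t|\,\mathbb{B}_{\mathbb{H}^n}$ for any $t\in\mathbb{R}$, where $\Gamma(t)=\{X\in\Omega : \sum_{i=\kappa+1}^n\sigma_i(X)=t\}$.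
   Context: $\mathbb{H}^n$ is the space of $n\times n$ Hermitian matrices with the trace inner product and Frobenius norm $\|\cdot\|_F$; $\mathbb{H}^n_+$ is the cone of Hermitian positive semidefinite matrices; $\mathrm{dist}$ is the distance in $\|\cdot\|_F$. $\lambda_1(X)\ge\cdots\ge\lambda_n(X)$ are the eigenvalues of $X$ (with $\lambda_i(X)u_iu_i^{\mathbb{T}}$ taken as $0$ for $i>n$), the $u_i$ are complex orthonormal column vectors and $u_i^{\mathbb{T}}$ denotes the conjugate transpose. $\sigma_1(X)\ge\cdots\ge\sigma_n(X)$ are the singular values, $\|\cdot\|_*$ is the nuclear norm (sum of singular values), empty sums are $0$, and $\mathbb{B}_{\mathbb{H}^n}$ is the closed unit ball of $\mathbb{H}^n$ in $\|\cdot\|_F$ centered at the origin. *)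

(* Defs.v *)
From HB Require Import structures.
From mathcomp Require Import all_boot all_order all_algebra.
From mathcomp Require Import complex.
From mathcomp Require Import classical_sets reals.

Set Implicit Arguments.
Unset Strict Implicit.
Unset Printing Implicit Defensive.

Import Order.TTheory GRing.Theory Num.Theory.

Local Open Scope ring_scope.
Local Open Scope complex_scope.
Local Open Scope sesquilinear_scope.
Local Open Scope classical_set_scope.

Section HermitianMatrices.
Context {R : realType} {n : nat}.
Implicit Types (X Y : 'M[R[i]]_n) (A B : set 'M[R[i]]_n) (kappa : nat).

Definition herm : set 'M[R[i]]_n := [set X | X \is hermsymmx].

(* In the partial order of R[i], 0 <= z says that z is real and nonnegative. *)
Definition herm_psd : set 'M[R[i]]_n :=
  [set X | herm X /\ forall x : 'cV[R[i]]_n, 0 <= (x ^t* *m X *m x) ord0 ord0].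

(* tr(X^* Y) is already real for Hermitian X and Y; the real part only changes
   the type from R[i] to R. *)
Definition trace_dot X Y : R := complex.Re (\tr (X ^t* *m Y)).

Definition frob X : R := Num.sqrt (trace_dot X X).

Definition dist X A : R := inf [set frob (X - Y) | Y in A].

(* The roots of the characteristic polynomial, with multiplicity, in
   nonincreasing order. It is meant for Hermitian matrices, whose eigenvalues
   are real. *)
Definition eigvals X : seq R :=
  sort >=%O [seq complex.Re z | z <- sval (closed_field_poly_normal (char_poly X))].

(* Indices start at 0: eigval X i is the (i+1)-st largest eigenvalue, and
   likewise for singval. Both are 0 for i >= n. *)
Definition eigval X (i : nat) : R := (eigvals X)`_i.

Definition singvals X : seq R :=
  [seq Num.sqrt s | s <- eigvals (X ^t* *m X)].

Definition singval X (i : nat) : R := (singvals X)`_i.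

Definition nuclear X : R := \sum_(0 <= i < n) singval X i.

Definition orthonormal_family (u : 'I_n -> 'cV[R[i]]_n) : Prop :=
  forall i j, (u i) ^t* *m u j = ((i == j)%:R)%:M.

Definition eigen_decomposition X (u : 'I_n -> 'cV[R[i]]_n) : Prop :=
  orthonormal_family u /\
  X = \sum_(i < n) (eigval X i)%:C *: (u i *m (u i) ^t*).

(* The range i < n, i < kappa encodes that terms beyond the n-th are 0 when
   kappa > n. *)
Definition PiR kappa X (u : 'I_n -> 'cV[R[i]]_n) : 'M[R[i]]_n :=
  \sum_(i < n | (i < kappa)%N) (eigval X i)%:C *: (u i *m (u i) ^t*).

Definition Omega : set 'M[R[i]]_n := [set X | herm_psd X /\ \tr X = 1].

Definition lowrank kappa : set 'M[R[i]]_n :=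
  [set X | Omega X /\ (\rank X <= kappa)%N].

Definition Gamma kappa (t : R) : set 'M[R[i]]_n :=
  [set X | Omega X /\ \sum_(kappa <= i < n) singval X i = t].

Definition unit_ball : set 'M[R[i]]_n := [set X | herm X /\ frob X <= 1].

Definition minkowski A B : set 'M[R[i]]_n := [set X + Y | X in A & Y in B].

Definition dilate (c : R) A : set 'M[R[i]]_n := [set c%:C *: X | X in A].

End HermitianMatrices.

Arguments Omega : clear implicits.
Arguments lowrank : clear implicits.
Arguments Gamma : clear implicits.
Arguments unit_ball : clear implicits.

(* Main.v *)
(* Write X = sum_i c_i u_i u_i^* with c the eigenvalues. Moving the discarded
   mass s = sum_(i >= kappa) c_i onto the leading coefficient gives
   Y = sum_(i < kappa) c_i u_i u_i^* + s u_0 u_0^*, which is still positive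
   semidefinite of trace one but has rank at most kappa, and
   |X - Y|_F^2 = sum_(i >= kappa) c_i^2 + s^2.  Here the first term is
   |X - PiR X|_F^2 and s = |X - PiR X|_*; moreover the first term is at most
   s^2, so |X - Y|_F <= sqrt 2 s.  Raising c_0 keeps c nonincreasing, so for the
   second claim the coefficients of Y are its singular values in order. *)
Require Import Defs.
From HB Require Import structures.
From mathcomp Require Import all_boot all_order all_algebra.
From mathcomp Require Import perm.
From mathcomp Require Import complex.
From mathcomp Require Import classical_sets reals.
Import Order.TTheory GRing.Theory Num.Theory.
Local Open Scope ring_scope.
Local Open Scope complex_scope.
Local Open Scope classical_set_scope.

(** * Real combinations of the matrices [u i *m (u i)^t*] *)

Section SpectralSums.
Local Open Scope sesquilinear_scope.

Lemma conj_real_complex (R : rcfType) (a : R) : (a%:C)^*%R = a%:C.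
Proof. by apply: CrealP; apply/complex_realP; exists a. Qed.

Lemma ctmx_mul (C : numClosedFieldType) m n p (A : 'M[C]_(m, n)) (B : 'M[C]_(n, p)) :
  (A *m B)^t* = B^t* *m A^t*.
Proof. by rewrite trmx_mul map_mxM. Qed.

(** All matrices compared in the proof share one family [u], so questions about them reduce to their
    real coefficients. The coefficients may be unsorted or negative, which lets differences be
    written in the same form. *)
Definition specmx {R : realType} {n : nat} (u : 'I_n -> 'cV[R[i]]_n) (c : 'I_n -> R) :=
  \sum_(i < n) (c i)%:C *: (u i *m (u i)^t*).

Lemma specmxB {R : realType} {n : nat} (u : 'I_n -> 'cV[R[i]]_n) (c d : 'I_n -> R) :
  specmx u c - specmx u d = specmx u (fun i => c i - d i).
Proof.
rewrite /specmx -sumrB; apply: eq_bigr => i _.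
by rewrite rmorphB scalerBl.
Qed.

Lemma specmxZ {R : realType} {n : nat} (u : 'I_n -> 'cV[R[i]]_n) a (c : 'I_n -> R) :
  a%:C *: specmx u c = specmx u (fun j => a * c j).
Proof.
by rewrite /specmx scaler_sumr; apply: eq_bigr => j _; rewrite scalerA rmorphM.
Qed.

Lemma eq_specmx {R : realType} {n : nat} (u : 'I_n -> 'cV[R[i]]_n) (c d : 'I_n -> R) :
  c =1 d -> specmx u c = specmx u d.
Proof. by move=> cd; apply: eq_bigr => i _; rewrite cd. Qed.

Lemma ctmx_specmx {R : realType} {n : nat} (u : 'I_n -> 'cV[R[i]]_n) (c : 'I_n -> R) :
  (specmx u c)^t* = specmx u c.
Proof.
rewrite /specmx raddf_sum /= raddf_sum; apply: eq_bigr => i _ /=.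
rewrite linearZ /= map_mxZ ctmx_mul trmxCK.
by rewrite [_ (c i)%:C]conj_real_complex.
Qed.

Lemma specmx_hermsym {R : realType} {n : nat} (u : 'I_n -> 'cV[R[i]]_n) (c : 'I_n -> R) :
  herm (specmx u c).
Proof. by apply/is_hermitianmxP; rewrite expr0 scale1r ctmx_specmx. Qed.

(** Each summand factors through the scalar [(u i)^t* *m x]. This serves both to prove positivity
    and, with [x := u i], to recover a coefficient. *)
Lemma specmx_quad {R : realType} {n : nat} (u : 'I_n -> 'cV[R[i]]_n) (c : 'I_n -> R)
    (x : 'cV[R[i]]_n) :
  (x^t* *m specmx u c *m x) ord0 ord0 =
  \sum_(i < n) (c i)%:C * `|((u i)^t* *m x) ord0 ord0| ^+ 2.
Proof.
rewrite /specmx mulmx_sumr mulmx_suml summxE; apply: eq_bigr => i _.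
rewrite -scalemxAr -scalemxAl mxE; congr (_ * _).
rewrite [x^t* *m _]mulmxA -[_ *m x]mulmxA mxE big_ord1 normCKC.
have -> : x^t* *m u i = ((u i)^t* *m x)^t* by rewrite ctmx_mul trmxCK.
by rewrite !mxE.
Qed.

Lemma specmx_psd {R : realType} {n : nat} (u : 'I_n -> 'cV[R[i]]_n) (c : 'I_n -> R) :
  (forall i, 0 <= c i) -> herm_psd (specmx u c).
Proof.
move=> c0; split; first exact: specmx_hermsym.
move=> x; rewrite specmx_quad; apply: sumr_ge0 => i _.
by rewrite mulr_ge0 ?exprn_ge0 // ler0c.
Qed.

(** Rank is subadditive, each rank-one term contributes at most 1, and at most [k] indices lie below
    [k]. *)
Lemma rank_specmx {R : realType} {n k : nat} (u : 'I_n -> 'cV[R[i]]_n) (c : 'I_n -> R) :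
  (forall i : 'I_n, (k <= i)%N -> c i = 0) -> (\rank (specmx u c) <= k)%N.
Proof.
move=> c0; rewrite /specmx (bigID (fun i : 'I_n => (i < k)%N)) /=.
rewrite [X in _ + X]big1 ?addr0; last first.
  by move=> i; rewrite -leqNgt => /c0 ->; rewrite scale0r.
have: (\sum_(i < n | (i < k)%N) 1 <= k)%N.
  rewrite sum1_card.
  rewrite -[X in (_ <= X)%N](size_iota 0) cardE -(size_map val).
  apply: uniq_leq_size; first by rewrite map_inj_uniq ?enum_uniq //; exact: val_inj.
  by move=> j /mapP => -[k0]; rewrite mem_enum mem_iota => + ->.
apply: leq_trans.
elim/big_ind2: _ => [|A a B b Aa Bb|i _]; first by rewrite mxrank0.
  by apply: leq_trans (mxrank_add _ _) _; rewrite leq_add.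
apply: leq_trans (mxrank_scale _ _) _.
by apply: leq_trans (mxrankM_maxl _ _) _; rewrite rank_leq_col.
Qed.

(** * Trace, norms and spectrum when [u] is orthonormal *)

Section Orthonormal.
Context {R : realType} {n : nat} {u : 'I_n -> 'cV[R[i]]_n}.
Hypothesis uo : orthonormal_family u.
Implicit Types c d : 'I_n -> R.

Lemma specmxM c d : specmx u c *m specmx u d = specmx u (fun i => c i * d i).
Proof.
rewrite /specmx mulmx_suml; apply: eq_bigr => i _.
rewrite mulmx_sumr (bigD1 i) //= big1 ?addr0 => [|j ji].
  rewrite -scalemxAl -scalemxAr scalerA mulmxA -(mulmxA (u i)).
  by rewrite uo eqxx mulmx1 rmorphM.
rewrite -scalemxAl -scalemxAr mulmxA -(mulmxA (u i)) uo.
by rewrite eq_sym (negPf ji) raddf0 mulmx0 mul0mx !scaler0.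
Qed.

Lemma mxtrace_specmx c : \tr (specmx u c) = (\sum_i c i)%:C.
Proof.
rewrite /specmx raddf_sum /= rmorph_sum; apply: eq_bigr => i _ /=.
by rewrite mxtraceZ mxtrace_mulC uo eqxx mxtrace1 mulr1.
Qed.

Lemma frob_specmx c : frob (specmx u c) = Num.sqrt (\sum_i c i ^+ 2).
Proof.
by rewrite /frob /trace_dot [map_mx _ _]ctmx_specmx specmxM mxtrace_specmx.
Qed.

Lemma specmx_eigenvalue c i : ((u i)^t* *m specmx u c *m u i) ord0 ord0 = (c i)%:C.
Proof.
rewrite specmx_quad (bigD1 i) //= big1 ?addr0 => [|j ji].
  by rewrite uo eqxx mxE mulr1n normr1 expr1n mulr1.
by rewrite uo (negPf ji) mxE mul0rn normr0 expr0n mulr0.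
Qed.

Lemma psd_specmx_ge0 c i : herm_psd (specmx u c) -> 0 <= c i.
Proof. by case=> _ /(_ (u i)); rewrite specmx_eigenvalue ler0c. Qed.

Lemma specmx_Omega c :
  (forall i, 0 <= c i) -> \sum_i c i = 1 -> Omega R n (specmx u c).
Proof. by move=> c0 c1; split; [exact: specmx_psd | rewrite mxtrace_specmx c1]. Qed.

Lemma Omega_specmx c :
  Omega R n (specmx u c) -> (forall i, 0 <= c i) /\ \sum_i c i = 1.
Proof.
case=> cpsd; rewrite mxtrace_specmx => c1; split; last exact: complexI.
by move=> i; apply: psd_specmx_ge0 cpsd.
Qed.

(** The matrix [U] with columns [u j] is unitary, so the sum is similar to the diagonal matrix [D],
    and similar matrices have equal characteristic polynomials. *)
Lemma char_poly_specmx c :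
  char_poly (specmx u c) = \prod_(i < n) ('X - ((c i)%:C)%:P).
Proof.
pose U := \matrix_(i, j) u j i ord0 : 'M[R[i]]_n.
pose D := diag_mx (\row_i (c i)%:C) : 'M[R[i]]_n.
have UU : U^t* *m U = 1%:M.
  apply/matrixP => i j; have /matrixP/(_ ord0 ord0) := uo i j.
  rewrite !mxE eqxx mulr1n => <-; apply: eq_bigr => k _.
  by rewrite !mxE.
have SE : specmx u c = U *m D *m U^t*.
  apply/matrixP => i j; rewrite /specmx summxE [RHS]mxE; apply: eq_bigr => k _.
  rewrite mxE mul_mx_diag !mxE big_ord1 !mxE.
  by rewrite mulrA [_ * u k i _]mulrC.
have -> : char_poly (specmx u c) = char_poly D.
  rewrite /char_poly /char_poly_mx SE !map_mxM /=.
  set V := map_mx polyC U; set W := map_mx polyC (U^t*).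
  have VW : V *m W = 1%:M by rewrite -map_mxM (mulmx1C UU) map_mx1.
  have XE : 'X%:M = V *m 'X%:M *m W by rewrite mul_mx_scalar -scalemxAl VW scalemx1.
  rewrite {1}XE -mulmxBl -mulmxBr !det_mulmx mulrAC.
  by rewrite -det_mulmx VW det1 mul1r.
rewrite char_poly_trig; last exact/is_diag_mx_is_trig/diag_mx_is_diag.
by apply: eq_bigr => i _; rewrite !mxE eqxx mulr1n.
Qed.

(** A product of monic linear factors determines its roots up to permutation, so the root list
    picked by [closed_field_poly_normal] sorts to the same result. *)
Lemma eigvals_specmx c : eigvals (specmx u c) = sort >=%O (codom c).
Proof.
rewrite /eigvals; case: closed_field_poly_normal => s /= sE.
apply/perm_sortP; [exact: ge_total|exact: ge_trans|exact: ge_anti|].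
have /(perm_map (@complex.Re R)) : perm_eq s [seq (c i)%:C | i : 'I_n].
  refine (@prod_XsubC_eq (R[i]) _ _ _); rewrite big_image /= -char_poly_specmx sE.
  by rewrite (monicP (char_poly_monic _)) scale1r.
by rewrite -map_comp; congr perm_eq; apply: eq_map.
Qed.

Lemma sorted_codom_ord c :
  {homo c : i j / (i <= j)%N >-> j <= i} -> sorted >=%O (codom c).
Proof.
move=> c_mono; rewrite /codom /image_mem.
apply: (@homo_sorted _ _ c (relpre val leq) >=%O c_mono).
by rewrite -sorted_map val_enum_ord iota_sorted.
Qed.

(** Here [X^t* *m X] has coefficients [c i * c i], whose square roots are absolute values;
    monotonicity of the root preserves the sorting. *)
Lemma singvals_specmx c :
  singvals (specmx u c) = sort >=%O (codom (fun i => `|c i|)).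
Proof.
apply: (sorted_eq ge_trans ge_anti).
- rewrite /singvals; apply: (homo_sorted (e := >=%O)) => [x y /= xy|].
    exact: ler_wsqrtr.
  by rewrite /eigvals; apply: sort_sorted; exact: ge_total.
- by apply: sort_sorted; exact: ge_total.
rewrite /singvals [map_mx _ _]ctmx_specmx specmxM eigvals_specmx.
rewrite perm_sym perm_sort perm_sym.
have /permPl/(perm_map Num.sqrt)/perm_trans := perm_sort >=%O (codom (fun i => c i * c i)).
apply; rewrite -map_comp.
by rewrite (eq_map (g := fun i => `|c i|)) // => i /=; rewrite -expr2 sqrtr_sqr.
Qed.

Lemma nuclear_specmx c : nuclear (specmx u c) = \sum_i `|c i|.
Proof.
(* The list has exactly [n] entries, so the default 0 is never read in [nuclear]. *)
have sz : size (singvals (specmx u c)) = n.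
  by rewrite singvals_specmx size_sort size_codom card_ord.
transitivity (\sum_(x <- singvals (specmx u c)) x).
  by rewrite (big_nth 0) sz.
rewrite singvals_specmx (perm_big (codom (fun i => `|c i|))); last by rewrite perm_sort.
by rewrite big_image.
Qed.

Lemma singval_specmx c (i : 'I_n) :
  (forall j, 0 <= c j) -> {homo c : j k / (j <= k)%N >-> k <= j} ->
  singval (specmx u c) i = c i.
Proof.
move=> c0 c_mono; rewrite /singval singvals_specmx.
have -> : codom (fun j => `|c j|) = codom c.
  by apply: eq_map => j; rewrite ger0_norm.
rewrite (sorted_sort ge_trans) ?sorted_codom_ord //.
by rewrite (nth_map i) ?size_enum_ord // nth_ord_enum.
Qed.
End Orthonormal.

(** * Truncation and sorted spectral decompositions *)

Lemma specmx_PiR {R : realType} {n : nat} (k : nat) (X : 'M[R[i]]_n) u :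
  PiR k X u = specmx u (fun j => if (j < k)%N then eigval X j else 0).
Proof.
rewrite /PiR /specmx big_mkcond; apply: eq_bigr => j _.
by case: ifP => // _; rewrite scale0r.
Qed.

Lemma hermitian_spectral {R : realType} {n : nat} {X : 'M[R[i]]_n} : herm X ->
  exists u c, [/\ orthonormal_family u, X = specmx u c
                & {homo c : j k / (j <= k)%N >-> k <= j}].
Proof.
move=> hX; have /hermitian_spectral_diag_real D_real := hX.
have /hermitian_normalmx/orthomx_spectralP := hX.
have P_unit := spectral_unitarymx X.
rewrite invmx_unitary //; move: D_real P_unit.
move: (spectralmx X) (spectral_diag X) => P D /mxOverP D_real P_unit XE.
pose c0 j := complex.Re (D ord0 j).
have c0E j : (c0 j)%:C = D ord0 j by rewrite RRe_real.
(* The spectral theorem gives the eigenvalues in no particular order; [s] is a permutation sorting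
   them. *)
have [s sE] : exists s : {perm 'I_n},
    sort >=%O (codom c0) = [seq c0 (s j) | j <- enum 'I_n].
  have /tuple_permP [s ->] : perm_eq (sort >=%O (codom c0)) [tuple c0 j | j < n].
    by rewrite perm_sort.
  by exists s; apply: eq_map => j; rewrite tnth_mktuple.
(* Since [X] is [P^t* *m diag_mx D *m P], the eigenvectors are the conjugate transposed rows of [P],
   relabelled by [s]. *)
exists (fun j => (row (s j) P)^t*), (fun j => c0 (s j)); split.
- move=> j k; rewrite trmxCK; apply/matrixP => a b; rewrite !ord1.
  have /row_unitarymxP/(_ (s j) (s k)) := P_unit.
  by rewrite dotmxE => ->; rewrite mxE mulr1n (inj_eq perm_inj).
- rewrite XE /specmx [RHS](reindex_inj (@perm_inj _ s^-1)) /=.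
  apply/matrixP => a b; rewrite summxE mxE; apply: eq_bigr => k _.
  rewrite mul_mx_diag permKV c0E trmxCK !mxE big_ord1 !mxE.
  by rewrite mulrAC mulrC mulrA.
- move=> j k jk.
  have sorted_c : sorted >=%O [seq c0 (s j) | j <- enum 'I_n].
    by rewrite -sE; apply: sort_sorted; exact: ge_total.
  have nthE (l : 'I_n) : nth 0 [seq c0 (s j) | j <- enum 'I_n] l = c0 (s l).
    by rewrite (nth_map l) ?size_enum_ord // nth_ord_enum.
  rewrite -!nthE.
  by apply: (sorted_leq_nth ge_trans ge_refl) => //;
    rewrite inE size_map size_enum_ord.
Qed.
End SpectralSums.

(** * Moving the tail of a real sequence onto one leading index *)

Section Concentrate.
Context {R : realType} {n : nat} (k : nat) (o : 'I_n).
Hypothesis ok : (o < k)%N.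
Implicit Types c : 'I_n -> R.

Definition tail c := \sum_(j < n | (k <= j)%N) c j.

(** The receiving index [o] is a parameter because ['I_n] has no element when [n] is 0. *)
Definition concentrate c (j : 'I_n) : R :=
  (if (j < k)%N then c j else 0) + (if j == o then tail c else 0).

Lemma concentrate_ge0 c : (forall j, 0 <= c j) -> forall j, 0 <= concentrate c j.
Proof.
move=> c0 j; apply: addr_ge0; case: ifP => // _.
by apply: sumr_ge0.
Qed.

Lemma concentrate_eq0 c (j : 'I_n) : (k <= j)%N -> concentrate c j = 0.
Proof.
move=> kj; rewrite /concentrate ltnNge kj /=.
by case: eqP kj => [->|_ _]; rewrite ?addr0 // leqNgt ok.
Qed.

Lemma sum_concentrate c : \sum_j concentrate c j = \sum_j c j.
Proof.
rewrite big_split -!big_mkcond big_pred1_eq /= [RHS](bigID (fun j : 'I_n => (j < k)%N)) /=.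
by congr (_ + _); apply: eq_bigl => j; rewrite leqNgt.
Qed.

(** Below [k] the difference lives only at [o], with value [- tail c]; from [k] on it is [c] itself.
    Since [o < k], the two contributions never overlap. *)
Lemma sum_sqr_sub_concentrate c :
  \sum_j (c j - concentrate c j) ^+ 2 =
  \sum_(j < n | (k <= j)%N) c j ^+ 2 + tail c ^+ 2.
Proof.
rewrite -[tail c ^+ 2](big_pred1_eq +%R o (fun=> tail c ^+ 2)).
rewrite [X in _ = X + _]big_mkcond [X in _ = _ + X]big_mkcond -big_split; apply: eq_bigr => j _ /=.
rewrite /concentrate [(k <= j)%N]leqNgt; case: ltnP => kj /=.
  by rewrite opprD addNKr add0r; case: ifP; rewrite sqrrN // expr0n.
have /negPf -> : j != o by apply: contraTneq kj => ->; rewrite -ltnNge.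
by rewrite !addr0 subr0.
Qed.

Lemma concentrate_homo c : nat_of_ord o = 0%N ->
  (forall j, 0 <= c j) -> {homo c : i j / (i <= j)%N >-> j <= i} ->
  {homo concentrate c : i j / (i <= j)%N >-> j <= i}.
Proof.
move=> o0 c0 c_mono i j ij; rewrite /concentrate; apply: lerD.
  case: (ltnP j k) => jk; first by rewrite (leq_ltn_trans ij jk) c_mono.
  by case: ifP.
have [jo|_] := eqVneq j o; last by case: ifP => // _; apply: sumr_ge0.
have -> : i = o by apply: val_inj; apply/eqP; move: ij; rewrite jo /= o0 leqn0.
by rewrite eqxx.
Qed.

(** Each nonnegative term is at most the whole tail, so [c j ^+ 2 <= c j * tail c]; then sum over
    [j]. *)
Lemma sum_sqr_le_tail c : (forall j, 0 <= c j) ->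
  \sum_(j < n | (k <= j)%N) c j ^+ 2 <= tail c ^+ 2.
Proof.
move=> c0; rewrite expr2 {1}/tail mulr_suml; apply: ler_sum => j kj.
rewrite expr2 ler_wpM2l // /tail (bigD1 j) //= lerDl.
by apply: sumr_ge0.
Qed.
End Concentrate.

(** * The distance bound and the inclusion between level sets *)

Lemma Omega_ord0 {R : realType} {n : nat} {X : 'M[R[i]]_n} :
  Omega R n X -> exists o : 'I_n, nat_of_ord o = 0%N.
Proof.
case: n X => [|n] X [_]; last by exists ord0.
(* For [n = 0] the trace is an empty sum and cannot equal 1. *)
by rewrite /mxtrace big_ord0 => /eqP; rewrite eq_sym oner_eq0.
Qed.

Theorem proposition2p2 (R : realType) (n kappa : nat) (kappa_gt0 : (0 < kappa)%N) :
  (forall (X : 'M[R[i]]_n) (u : 'I_n -> 'cV[R[i]]_n),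
     Omega R n X -> eigen_decomposition X u ->
     dist X (lowrank R n kappa)
       <= Num.sqrt (frob (X - PiR kappa X u) ^+ 2
                    + nuclear (X - PiR kappa X u) ^+ 2)) /\
  (forall t : R,
     Gamma R n kappa t
       `<=` minkowski (Gamma R n kappa 0)
                      (dilate (Num.sqrt 2 * `|t|) (unit_ball R n))).
Proof.
split=> [X u OX [uo XE]|t X [OX tX]]; have [o o0] := Omega_ord0 OX.
  have ok : (o < kappa)%N by rewrite o0.
  rewrite specmx_PiR; set c := fun j : 'I_n => eigval X j.
  have {}XE : X = specmx u c by [].
  have [c0 c1] : (forall j, 0 <= c j) /\ \sum_j c j = 1.
    by apply: (Omega_specmx uo); rewrite -XE.
  pose Y := specmx u (concentrate kappa o c).
  have YF : lowrank R n kappa Y.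
    split; last by apply: rank_specmx => j; exact: concentrate_eq0.
    apply: (specmx_Omega uo); first exact: concentrate_ge0.
    by rewrite sum_concentrate.
  have tailE : X - specmx u (fun j => if (j < kappa)%N then c j else 0) =
      specmx u (fun j => if (kappa <= j)%N then c j else 0).
    rewrite XE specmxB; apply: eq_specmx => j; rewrite [(kappa <= j)%N]leqNgt.
    by case: ltnP => _; rewrite ?subrr ?subr0.
  (* The infimum is at most its value at the feasible point [Y], as norms are bounded below by 0. *)
  apply: (@le_trans _ _ (frob (X - Y))).
    apply: ge_inf; last by exists Y.
    by exists 0 => _ [Z _ <-]; exact: sqrtr_ge0.
  rewrite [in leRHS]tailE (frob_specmx uo) (nuclear_specmx uo).
  rewrite XE specmxB (frob_specmx uo) sum_sqr_sub_concentrate //.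
  rewrite sqr_sqrtr; last by apply: sumr_ge0 => j _; exact: sqr_ge0.
  (* For this [Y] the two radicands are in fact equal. *)
  apply: ler_wsqrtr; rewrite le_eqVlt; apply/orP; left; apply/eqP.
  congr (_ + _ ^+ 2); rewrite [LHS]big_mkcond; apply: eq_bigr => j _.
    by case: ifP; rewrite ?expr0n.
  by case: ifP => _; rewrite ?normr0 // ger0_norm.
(* The general case divides by a multiple of [|t|]; at [t = 0] the point [X] itself works, with zero
   displacement. *)
have [t0|t_neq0] := eqVneq t 0.
  exists X; first by split=> //; rewrite tX.
  exists 0; last by rewrite addr0.
  exists 0; last by rewrite scaler0.
  split; first by apply/is_hermitianmxP; rewrite trmx0 map_mx0 scaler0.
  by rewrite /frob /trace_dot mulmx0 mxtrace0 sqrtr0.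
have ok : (o < kappa)%N by rewrite o0.
(* A decomposition with sorted coefficients is chosen, so that the tail of singular values is the
   tail of [c]. *)
have [u [c [uo XE c_mono]]] := hermitian_spectral OX.1.1.
have [c0 c1] : (forall j, 0 <= c j) /\ \sum_j c j = 1.
  by apply: (Omega_specmx uo); rewrite -XE.
have sum_tail (d : 'I_n -> R) : (forall j, 0 <= d j) -> {homo d : i j / (i <= j)%N >-> j <= i} ->
    \sum_(kappa <= j < n) singval (specmx u d) j = tail kappa d.
  move=> d0 d_mono; rewrite big_geq_mkord; apply: eq_bigr => j kj.
  exact: singval_specmx.
have {}tX : tail kappa c = t by rewrite -sum_tail // -XE.
pose Y := specmx u (concentrate kappa o c).
have YG : Gamma R n kappa 0 Y.
  have d0 := concentrate_ge0 kappa o c c0.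
  split; first by apply: (specmx_Omega uo); rewrite ?sum_concentrate.
  (* The order must survive concentration, which uses that [o] is the first index; the tail of
     singular values of [Y] is then a sum of zeros. *)
  rewrite sum_tail //; last exact: concentrate_homo.
  by rewrite /tail big1 // => j; exact: concentrate_eq0.
set r := Num.sqrt 2 * `|t|.
have XYE : X - Y = specmx u (fun j => c j - concentrate kappa o c j).
  by rewrite XE specmxB.
have frob_le : frob (X - Y) <= r.
  rewrite XYE (frob_specmx uo) sum_sqr_sub_concentrate // tX.
  (* The constant 2 arises as [t ^+ 2 + t ^+ 2]: one copy is the moved mass squared, the other
     bounds the discarded squares. *)
  rewrite /r -sqrtr_sqr -sqrtrM // ler_wsqrtr // mulr_natl mulr2n lerD2r.
  by rewrite -tX; exact: sum_sqr_le_tail.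
have r_gt0 : 0 < r by rewrite mulr_gt0 ?sqrtr_gt0 ?normr_gt0.
have XYr : r%:C *: (r^-1%:C *: (X - Y)) = X - Y.
  by rewrite scalerA -rmorphM /= divff ?scale1r // gt_eqF.
exists Y => //; exists (X - Y); last by rewrite addrC subrK.
(* The displacement [X - Y] is rescaled by the positive radius [r] to land in the unit ball. *)
exists (r^-1%:C *: (X - Y)) => //; split.
  by rewrite XYE specmxZ; exact: specmx_hermsym.
suff -> : frob (r^-1%:C *: (X - Y)) = r^-1 * frob (X - Y).
  by rewrite mulrC ler_pdivrMr // mul1r.
rewrite XYE specmxZ !(frob_specmx uo).
under eq_bigr do rewrite exprMn.
by rewrite -mulr_sumr sqrtrM ?sqr_ge0 // sqrtr_sqr ger0_norm // invr_ge0 ltW.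
Qed.
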